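(* Let $n,L\ge 1$ be integers. Let $\mathcal{S}_{n,L,\lambda,z}$ be the reflecting stochastic symplectic ice (where $\lambda$ is a partition with exactly $n$ parts, zeros allowed, $L\ge\lambda_1+n$), and let $\mathcal{T}_{n,L,\lambda,z}$ be the absorbing-and-emitting stochastic symplectic ice (where $\lambda$ is a partition with $n'\ge 1$ parts, zeros allowed, $L\ge\lambda_1+n'$), with partition functions $Z(\mathcal{S}_{n,L,\lambda,z})$ and $Z(\mathcal{T}_{n,L,\lambda,z})$. With $z_i'=q+1-\frac1{z_i}$, let $$D_1(n,L,z)=\prod_{i=1}^n z_i^L\prod_{i=1}^n\bigl(1-(q+1)z_i+q z_i z_i'^{-1}\bigr),\qquad D_2(n,L,z)=\prod_{i=1}^n z_i^L .$$ Then the rational functions $$\frac{Z(\mathcal{S}_{n,L,\lambda,z})}{D_1(n,L,z)}\quad\text{and}\quad \frac{Z(\mathcal{T}_{n,L,\lambda,z})}{D_2(n,L,z)}$$ of $z=(z_1,\dots,z_n)$ are invariant under any permutation of $z_1,\dots,z_n$ and under any interchange $z_i\leftrightarrow z_i'^{-1}$ ($1\le i\le n$), i.e. the substitution replacing $z_i$ by $1/z_i'$ (and hence $z_i'$ by $1/z_i$) and fixing the other variables.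
   Context: Parameters: $q$ and $z_1,\dots,z_n$ are indeterminates (equivalently, generic complex numbers for which every denominator appearing is nonzero); $z_i'=q+1-\frac{1}{z_i}$. Vertex weights. Edges carry spins in $\{+,-\}$. For a vertex with spins (left, top, right, bottom) $=(a,b,c,d)$: - stochastic $\Gamma$ vertex with spectral parameter $z_i$: $(+,+,+,+)\mapsto 1$, $(-,-,-,-)\mapsto 1$, $(+,-,+,-)\mapsto z_i$, $(-,+,-,+)\mapsto qz_i$, $(-,+,+,-)\mapsto 1-qz_i$, $(+,-,-,+)\mapsto 1-z_i$; all others have weight $0$. - stochastic $\Delta$ vertex with spectral parameter $z_i$: $(+,+,+,+)\mapsto 1$, $(-,-,-,-)\mapsto 1$, $(+,-,+,-)\mapsto z_i'$, $(-,+,-,+)\mapsto \frac1q z_i'$, $(-,-,+,+)\mapsto 1-z_i'$, $(+,+,-,-)\mapsto 1-\frac1q z_i'$; all others have weight $0$. Model. Take a rectangular lattice with $2n$ rows, numbered $1,\dots,2n$ from bottom to top, and $L$ columns, numbered $1,\dots,L$ from right to left. For $1\le i\le n$, all vertices of row $2i-1$ are stochastic $\Delta$ vertices with spectral parameter $z_i$ and all vertices of row $2i$ are stochastic $\Gamma$ vertices with spectral parameter $z_i$. Let $\lambda=(\lambda_1\ge\dots\ge\lambda_{n'}\ge 0)$ be a partition with $L\ge\lambda_1+n'$. Boundary conditions: left boundary edges carry $-$ on $\Gamma$ rows and $+$ on $\Delta$ rows; all top boundary edges carry $+$; the bottom boundary edges in columns $\lambda_i+n'+1-i$ ($1\le i\le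 n'$) carry $-$ and the other bottom boundary edges carry $+$. On the right, the right-most edges of rows $2i$ and $2i-1$ are joined by a cap, for each $i$; if row $2i$ has right-most spin $x$ and row $2i-1$ has right-most spin $y$, the cap has weight $K(x,y)$. - Reflecting stochastic symplectic ice $\mathcal{S}_{n,L,\lambda,z}$ (here $n'=n$): $K(+,+)=K(-,-)=1$, $K(+,-)=K(-,+)=0$. - Absorbing-and-emitting stochastic symplectic ice $\mathcal{T}_{n,L,\lambda,z}$: $K(+,-)=K(-,+)=1$, $K(+,+)=K(-,-)=0$. The partition function $Z(\cdot)$ is the sum, over all assignments of spins to the edges compatible with the boundary conditions, of the product of all vertex weights and all cap weights. *)

(* Defs.v *)
From HB Require Import structures.
From mathcomp Require Import all_boot all_order all_fingroup all_algebra.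
From mathcomp Require Import mpoly.

Set Implicit Arguments.
Unset Strict Implicit.
Unset Printing Implicit Defensive.

Import GRing.Theory.
Local Open Scope ring_scope.

Notation spin := bool (only parsing).
Notation Plus := true (only parsing).
Notation Minus := false (only parsing).

(* Everything is 0-based: z_{i+1} is [z i], row r+1 (from the bottom) is
   [r : 'I_n.*2], column j+1 (from the right) is [j : 'I_L]. *)

Section Weights.
Variables (F : fieldType) (q : F).

Definition zprime (x : F) : F := q + 1 - 1 / x.

(* The spins of a vertex are listed in the order left, top, right, bottom. *)
Definition gamma_weight (x : F) (a b c d : spin) : F :=
  match a, b, c, d with
  | Plus,  Plus,  Plus,  Plus  => 1
  | Minus, Minus, Minus, Minus => 1
  | Plus,  Minus, Plus,  Minus => x
  | Minus, Plus,  Minus, Plus  => q * x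
  | Minus, Plus,  Plus,  Minus => 1 - q * x
  | Plus,  Minus, Minus, Plus  => 1 - x
  | _, _, _, _ => 0
  end.

Definition delta_weight (x : F) (a b c d : spin) : F :=
  match a, b, c, d with
  | Plus,  Plus,  Plus,  Plus  => 1
  | Minus, Minus, Minus, Minus => 1
  | Plus,  Minus, Plus,  Minus => zprime x
  | Minus, Plus,  Minus, Plus  => 1 / q * zprime x
  | Minus, Minus, Plus,  Plus  => 1 - zprime x
  | Plus,  Plus,  Minus, Minus => 1 - 1 / q * zprime x
  | _, _, _, _ => 0
  end.

(* First argument: right-most spin of the Gamma row; second: of the Delta row. *)
Definition reflecting_cap (x y : spin) : F := if x == y then 1 else 0.
Definition absorbing_emitting_cap (x y : spin) : F := if x == y then 0 else 1.

End Weights.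

Lemma delta_row_subproof n (i : 'I_n) : (i.*2 < n.*2)%N.
Proof. by rewrite ltn_double. Qed.

Lemma gamma_row_subproof n (i : 'I_n) : (i.*2.+1 < n.*2)%N.
Proof. by rewrite ltn_Sdouble. Qed.

Definition delta_row n (i : 'I_n) : 'I_n.*2 := Ordinal (delta_row_subproof i).
Definition gamma_row n (i : 'I_n) : 'I_n.*2 := Ordinal (gamma_row_subproof i).

(* The vertical edge [(k, j)] of column j lies between rows k-1 and k, so that
   k = 0 is the bottom boundary and k = 2n the top boundary.  The horizontal
   edge [(r, k)] of row r lies between columns k-1 and k, so that k = 0 is the
   right-most edge and k = L the left boundary. *)
Definition vspins (n L : nat) := {ffun 'I_(n.*2).+1 * 'I_L -> spin}.
Definition hspins (n L : nat) := {ffun 'I_n.*2 * 'I_L.+1 -> spin}.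

Section Model.
Variables (F : fieldType) (n m L : nat) (lam : m.-tuple nat).
Variables (cap : spin -> spin -> F) (q : F) (z : 'I_n -> F).

Definition left_of (j : 'I_L) : 'I_L.+1 := lift ord0 j.
Definition right_of (j : 'I_L) : 'I_L.+1 := widen_ord (leqnSn L) j.
Definition above (r : 'I_n.*2) : 'I_(n.*2).+1 := lift ord0 r.
Definition below (r : 'I_n.*2) : 'I_(n.*2).+1 := widen_ord (leqnSn n.*2) r.

(* Column lambda_{i+1} + m + 1 - (i+1) has 0-based index lambda_{i+1} + (m-1-i);
   the subtraction is exact since i < m. *)
Definition bottom_spin (j : 'I_L) : spin :=
  if [exists i : 'I_m, (j : nat) == (tnth lam i + (m - i.+1))%N] then Minus else Plus.

Definition admissible (v : vspins n L) (h : hspins n L) : bool :=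
  [&& [forall i : 'I_n, h (gamma_row i, ord_max) == Minus],
      [forall i : 'I_n, h (delta_row i, ord_max) == Plus],
      [forall j : 'I_L, v (ord_max, j) == Plus]
    & [forall j : 'I_L, v (ord0, j) == bottom_spin j]].

Definition vertex (w : spin -> spin -> spin -> spin -> F)
    (v : vspins n L) (h : hspins n L) (r : 'I_n.*2) (j : 'I_L) : F :=
  w (h (r, left_of j)) (v (above r, j)) (h (r, right_of j)) (v (below r, j)).

Definition state_weight (v : vspins n L) (h : hspins n L) : F :=
  \prod_(i < n)
    ((\prod_(j < L) vertex (delta_weight q (z i)) v h (delta_row i) j) *
     (\prod_(j < L) vertex (gamma_weight q (z i)) v h (gamma_row i) j) *
     cap (h (gamma_row i, ord0)) (h (delta_row i, ord0))).

Definition partition_function : F :=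
  \sum_(v : vspins n L) \sum_(h : hspins n L | admissible v h) state_weight v h.

End Model.

Section Ice.
Variables (F : fieldType) (n L : nat).

Definition Z_reflecting (lam : n.-tuple nat) (q : F) (z : 'I_n -> F) : F :=
  partition_function L lam (@reflecting_cap F) q z.

Definition Z_absorbing_emitting (m : nat) (lam : m.-tuple nat)
    (q : F) (z : 'I_n -> F) : F :=
  partition_function L lam (@absorbing_emitting_cap F) q z.

Definition D1 (q : F) (z : 'I_n -> F) : F :=
  (\prod_(i < n) z i ^+ L) *
  \prod_(i < n) (1 - (q + 1) * z i + q * z i * (zprime q (z i))^-1).

Definition D2 (z : 'I_n -> F) : F := \prod_(i < n) z i ^+ L.

End Ice.

Definition interchange_z (F : fieldType) (n : nat) (q : F) (i : 'I_n)
    (z : 'I_n -> F) : 'I_n -> F :=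
  fun k => if k == i then (zprime q (z i))^-1 else z k.

(* The coefficients [K] may be any field, and the invariance is stated at the
   generic point of K(q, z_1, ..., z_n), where no denominator vanishes. *)
Definition ratfun (K : fieldType) (n : nat) : fieldType :=
  {fraction {mpoly K[n.+1]}}.

Definition q_var (K : fieldType) (n : nat) : ratfun K n :=
  @tofrac {mpoly K[n.+1]} 'X_ord0.

Definition z_var (K : fieldType) (n : nat) (i : 'I_n) : ratfun K n :=
  @tofrac {mpoly K[n.+1]} 'X_(lift ord0 i).

(* [f] is a formula in q and z_1, ..., z_n: a substitution acts on the rational
   function it denotes by changing the arguments of [f]. *)
Definition invariant_ratfun (K : fieldType) (n : nat)
    (f : ratfun K n -> ('I_n -> ratfun K n) -> ratfun K n) : Prop :=
  let q := q_var K n in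
  let z := @z_var K n in
  (forall s : 'S_n, f q (fun i => z (s i)) = f q z) /\
  (forall i : 'I_n, f q (interchange_z q i z) = f q z).

Definition is_partition (m : nat) (lam : m.-tuple nat) : bool := sorted geq lam.

(* Main.v *)
Require Import Defs.
From mathcomp Require Import all_boot all_order all_fingroup all_algebra.
From mathcomp Require Import ring.
From mathcomp Require Import mpoly.

Import GRing.Theory.
Local Open Scope ring_scope.

Set Implicit Arguments.
Unset Strict Implicit.
Unset Printing Implicit Defensive.

(** Reading a row pair as a transfer operator B(z) from the spins below to the
    spins above it, Z is a matrix entry of B(z_n) ... B(z_1), so it suffices to
    show that the B(z) commute and that B(z) / z^L is, up to an explicit scalar,
    unchanged under z -> 1/z'.  Both follow from the train argument.  For
    commutation, attach to the right of four rows the four crossings (caduceus)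
    that exchange the two row pairs and move them through the columns by
    Yang-Baxter equations; the caps are an eigenvector of this braid, and on the
    left the boundary spins leave only one nonzero weight, which is the same
    scalar.  For z -> 1/z', a single crossing (fish) turns the Gamma-Delta pair of
    parameter z into the pair of parameter 1/z'. *)

Lemma big_bool_pair (V : nmodType) (G : bool * bool -> V) :
  \sum_p G p = (G (true, true) + G (true, false)) +
               (G (false, true) + G (false, false)).
Proof.
transitivity (\sum_p G (p.1, p.2)); first by apply: eq_bigr; case.
by rewrite -(pair_bigA _ (fun a b => G (a, b))) /= !big_bool.
Qed.

(** * Transfer blocks and the train argument *)

Section Blocks.
Variable F : fieldType.

(* [P t s r l] is the weight of a column of one or more rows whose vertical
   boundary spins are [t] (top) and [s] (bottom) and whose horizontal spins are
   [r] on the right and [l] on the left. *)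
Definition block (S : Type) := spin -> spin -> S -> S -> F.

Definition row_block (w : spin -> spin -> spin -> spin -> F) : block bool :=
  fun t s r l => w l t r s.

Definition stack (S1 S2 : Type) (P : block S1) (Q : block S2) :
    block (S1 * S2) :=
  fun t s x y => \sum_(u : bool) P t u x.1 y.1 * Q u s x.2 y.2.

(** The RTT relation. Horizontal indices are read from right to left, so moving [X] from the left
    side of a column to its right side turns [P] into [Q]. *)
Definition intertwines (S : finType) (X : S -> S -> F) (P Q : block S) :=
  forall t s x y,
    \sum_(u : S) P t s x u * X u y = \sum_(u : S) X x u * Q t s u y.

Definition extend_down (S1 S2 : eqType) (X : S1 -> S1 -> F) :
    S1 * S2 -> S1 * S2 -> F :=
  fun x y => X x.1 y.1 * (x.2 == y.2)%:R.

Definition extend_up (S1 S2 : eqType) (X : S2 -> S2 -> F) :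
    S1 * S2 -> S1 * S2 -> F :=
  fun x y => (x.1 == y.1)%:R * X x.2 y.2.

Lemma sum_pair (S1 S2 : finType) (G : S1 * S2 -> F) :
  \sum_p G p = \sum_a \sum_b G (a, b).
Proof. by rewrite pair_bigA /=; apply: eq_bigr; case. Qed.

Lemma sum_eqr (S : finType) (G : S -> F) a :
  \sum_u G u * (u == a)%:R = G a.
Proof.
rewrite (bigD1 a) //= eqxx mulr1 big1 ?addr0 // => u /negPf->.
by rewrite mulr0.
Qed.

Lemma sum_eql (S : finType) (G : S -> F) a :
  \sum_u (a == u)%:R * G u = G a.
Proof.
by rewrite -[RHS](sum_eqr G); apply: eq_bigr => u _; rewrite mulrC eq_sym.
Qed.

(** [X] touches only the upper rows: for each value of the vertical spin [a] between the two parts,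
    the relation for [P] applies and the [Q] factor comes out. *)
Lemma intertwines_stackl (S1 S2 : finType) X (P P' : block S1) (Q : block S2) :
  intertwines X P P' ->
  intertwines (extend_down X) (stack P Q) (stack P' Q).
Proof.
move=> XP t s [x1 x2] [y1 y2]; rewrite !sum_pair /=.
rewrite /stack /extend_down /=.
transitivity (\sum_(a : bool) \sum_u P t a x1 u * X u y1 * Q a s x2 y2).
  rewrite [RHS]exchange_big /=; apply: eq_bigr => u _.
  transitivity (\sum_v (\sum_a P t a x1 u * Q a s x2 v * X u y1) *
                (v == y2)%:R).
    by apply: eq_bigr => v _; rewrite mulrA; congr (_ * _); rewrite mulr_suml.
  by apply: etrans (sum_eqr _ _) _; apply: eq_bigr => a _; ring.
transitivity (\sum_(a : bool) \sum_u X x1 u * P' t a u y1 * Q a s x2 y2).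
  by apply: eq_bigr => a _; rewrite -!mulr_suml XP.
rewrite exchange_big /=; apply: eq_bigr => u _.
transitivity (\sum_v (x2 == v)%:R *
                (\sum_a X x1 u * P' t a u y1 * Q a s v y2)).
  by apply/esym/(sum_eql (fun v => \sum_a X x1 u * P' t a u y1 * Q a s v y2)).
apply: eq_bigr => v _; rewrite !mulr_sumr; apply: eq_bigr => a _; ring.
Qed.

Lemma intertwines_stackr (S1 S2 : finType) X (P : block S1) (Q Q' : block S2) :
  intertwines X Q Q' ->
  intertwines (extend_up X) (stack P Q) (stack P Q').
Proof.
move=> XQ t s [x1 x2] [y1 y2]; rewrite !sum_pair /=.
rewrite exchange_big [RHS]exchange_big /= /stack /extend_up /=.
transitivity (\sum_(a : bool) \sum_u Q a s x2 u * X u y2 * P t a x1 y1).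
  rewrite [RHS]exchange_big /=; apply: eq_bigr => u _.
  transitivity (\sum_v (\sum_a P t a x1 v * Q a s x2 u * X u y2) *
                (v == y1)%:R).
    by apply: eq_bigr => v _; rewrite mulrCA mulrC; congr (_ * _); rewrite mulr_suml.
  by apply: etrans (sum_eqr _ _) _; apply: eq_bigr => a _; ring.
transitivity (\sum_(a : bool) \sum_u X x2 u * Q' a s u y2 * P t a x1 y1).
  by apply: eq_bigr => a _; rewrite -!mulr_suml XQ.
rewrite exchange_big /=; apply: eq_bigr => u _.
transitivity (\sum_v (x1 == v)%:R *
                (\sum_a X x2 u * Q' a s u y2 * P t a v y1)).
  by apply/esym/(sum_eql (fun v => \sum_a X x2 u * Q' a s u y2 * P t a v y1)).
apply: eq_bigr => v _; rewrite !mulr_sumr; apply: eq_bigr => a _; ring.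
Qed.

(** Four rows come bracketed as two row pairs; a crossing of the two middle rows needs these two
    bracketed together. *)
Definition regroup (A B C D : Type) (x : (A * B) * (C * D)) : A * ((B * C) * D) :=
  (x.1.1, ((x.1.2, x.2.1), x.2.2)).

Definition ungroup (A B C D : Type) (x : A * ((B * C) * D)) : (A * B) * (C * D) :=
  ((x.1, x.2.1.1), (x.2.1.2, x.2.2)).

Lemma ungroupK (A B C D : Type) : cancel (@ungroup A B C D) (@regroup A B C D).
Proof. by case=> [? [[? ?] ?]]. Qed.

Lemma ungroup_bij (A B C D : Type) : bijective (@ungroup A B C D).
Proof. by exists (@regroup A B C D) => [[? [[? ?] ?]]|[[? ?] [? ?]]]. Qed.

Lemma stack_regroup (A B C D : Type) (P : block A) (Q : block B)
    (R : block C) (T : block D) t s x y :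
  stack (stack P Q) (stack R T) t s x y =
  stack P (stack (stack Q R) T) t s (regroup x) (regroup y).
Proof. by rewrite /stack /regroup /= !big_bool /=; ring. Qed.

Definition extend_mid (A B C D : eqType) (X : B * C -> B * C -> F) :
    (A * B) * (C * D) -> (A * B) * (C * D) -> F :=
  fun x y => extend_up (extend_down X) (regroup x) (regroup y).

Lemma intertwines_mid (A B D : finType) (X : B * B -> B * B -> F)
    (P : block A) (Q Q' R R' : block B) (T : block D) :
  intertwines X (stack Q R) (stack R' Q') ->
  intertwines (extend_mid X) (stack (stack P Q) (stack R T))
                             (stack (stack P R') (stack Q' T)).
Proof.
move=> /(@intertwines_stackl _ _ _ _ _ T) /(@intertwines_stackr _ _ _ P) XQR.
move=> t s x y; rewrite 2!(reindex _ (onW_bij _ (@ungroup_bij A B B D))) /=.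
under eq_bigr do rewrite stack_regroup.
under [RHS]eq_bigr do rewrite stack_regroup.
under eq_bigr do rewrite /extend_mid ungroupK.
under [RHS]eq_bigr do rewrite /extend_mid ungroupK.
exact: XQR.
Qed.
End Blocks.

(** * Path sums with boundary vectors *)

Section Chain.
Variable F : fieldType.

(* Position 0 of a path is the right end of a row, or the bottom of the lattice. *)
Definition chain (S : finType) n (w : 'I_n -> S -> S -> F) (f g : S -> F) : F :=
  \sum_(e : {ffun 'I_n.+1 -> S})
    f (e ord0) *
    (\prod_(i < n) w i (e (widen_ord (leqnSn n) i)) (e (lift ord0 i))) *
    g (e ord_max).

Definition cons_ffun (S : finType) n (p : S * {ffun 'I_n -> S}) :
    {ffun 'I_n.+1 -> S} :=
  [ffun i => oapp p.2 p.1 (unlift ord0 i)].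

Lemma cons_ffun_bij (S : finType) n : bijective (@cons_ffun S n).
Proof.
exists (fun e : {ffun 'I_n.+1 -> S} =>
  (e ord0, [ffun i : 'I_n => e (lift ord0 i)])) => [[a e]|e].
  rewrite /cons_ffun ffunE unlift_none; congr pair.
  by apply/ffunP => i; rewrite !ffunE liftK.
by apply/ffunP => i; rewrite ffunE; case: unliftP => [j|] -> //=; rewrite ffunE.
Qed.

Lemma eq_chain (S : finType) n (w w' : 'I_n -> S -> S -> F) f f' g g' :
  (forall i x y, w i x y = w' i x y) -> f =1 f' -> g =1 g' ->
  chain w f g = chain w' f' g'.
Proof.
move=> ew ef eg; apply: eq_bigr => e _; rewrite ef eg.
by congr (_ * _ * _); apply: eq_bigr.
Qed.

Lemma chain_recl (S : finType) n (w : 'I_n.+1 -> S -> S -> F) f g :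
  chain w f g = chain (fun i => w (lift ord0 i))
                      (fun y => \sum_x f x * w ord0 x y) g.
Proof.
rewrite /chain (reindex _ (onW_bij _ (@cons_ffun_bij S n.+1))) sum_pair.
rewrite exchange_big /=; apply: eq_bigr => e _; rewrite !mulr_suml.
apply: eq_bigr => x _; rewrite big_ord_recl -!mulrA.
have c0 : cons_ffun (x, e) ord0 = x by rewrite ffunE unlift_none.
have cl i : cons_ffun (x, e) (lift ord0 i) = e i by rewrite ffunE liftK.
rewrite c0 (_ : widen_ord _ ord0 = ord0); last exact/val_inj.
rewrite c0 cl (_ : ord_max = lift ord0 ord_max); last exact/val_inj.
rewrite cl; congr (_ * (_ * (_ * _))); apply: eq_bigr => i _.
by rewrite (_ : widen_ord _ _ = lift ord0 (widen_ord (leqnSn n) i)) ?cl //;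
  apply/val_inj.
Qed.

Lemma chain0 (S : finType) (w : 'I_0 -> S -> S -> F) f g :
  chain w f g = \sum_x f x * g x.
Proof.
rewrite /chain (reindex _ (onW_bij _ (@cons_ffun_bij S 0))) sum_pair.
apply: eq_bigr => x _.
rewrite (big_pred1 ([ffun=> x] : {ffun 'I_0 -> S})) /=; last first.
  by move=> e; apply/esym/eqP/ffunP => -[].
by rewrite big_ord0 mulr1 (_ : ord_max = ord0) ?ffunE ?unlift_none //; apply/val_inj.
Qed.

(** The train argument. The first step is absorbed into [f], the induction hypothesis carries [X]
    through all later steps, and one use of [wX] carries it past the first. *)
Lemma chain_intertwine (S : finType) n (w w' : 'I_n -> S -> S -> F)
    (X : S -> S -> F) f g :
  (forall i x y, \sum_u w i x u * X u y = \sum_u X x u * w' i u y) ->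
  chain w f (fun x => \sum_y X x y * g y) =
  chain w' (fun y => \sum_x f x * X x y) g.
Proof.
elim: n w w' f => [|n IHn] w w' f wX.
  rewrite !chain0; under eq_bigr do rewrite mulr_sumr.
  rewrite exchange_big; apply: eq_bigr => y _; rewrite mulr_suml.
  by apply: eq_bigr => x _; rewrite mulrA.
rewrite !chain_recl (IHn _ (fun i => w' (lift ord0 i))); last first.
  by move=> i; apply: wX.
apply: eq_chain => // y.
under eq_bigr do rewrite mulr_suml.
under [RHS]eq_bigr do rewrite mulr_suml.
rewrite exchange_big [RHS]exchange_big /=; apply: eq_bigr => x _.
under eq_bigr do rewrite -mulrA.
under [RHS]eq_bigr do rewrite -mulrA.
by rewrite -!mulr_sumr wX.
Qed.

Lemma chain_mull (S : finType) n (w : 'I_n -> S -> S -> F) c f g :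
  chain w (fun x => c * f x) g = c * chain w f g.
Proof. by rewrite mulr_sumr; apply: eq_bigr => e _; rewrite !mulrA. Qed.

Lemma chain_mulr (S : finType) n (w : 'I_n -> S -> S -> F) c f g :
  chain w f (fun x => c * g x) = c * chain w f g.
Proof. by rewrite mulr_sumr; apply: eq_bigr => e _; rewrite mulrCA. Qed.

Lemma chain_mulw (S : finType) n (w : 'I_n -> S -> S -> F) (c : 'I_n -> F) f g :
  chain (fun i x y => c i * w i x y) f g = (\prod_i c i) * chain w f g.
Proof.
rewrite mulr_sumr; apply: eq_bigr => e _; rewrite big_split /=.
by rewrite mulrA mulrCA -!mulrA.
Qed.

Definition pair_ffun (I S1 S2 : finType) (p : {ffun I -> S1} * {ffun I -> S2}) :
    {ffun I -> S1 * S2} := [ffun i => (p.1 i, p.2 i)].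

Lemma pair_ffun_bij (I S1 S2 : finType) : bijective (@pair_ffun I S1 S2).
Proof.
exists (fun e : {ffun I -> S1 * S2} =>
  ([ffun i => (e i).1], [ffun i => (e i).2])) => [[e1 e2]|e].
  by congr pair; apply/ffunP => i; rewrite !ffunE.
by apply/ffunP => i; rewrite !ffunE; case: (e i).
Qed.

Lemma sum_prod_ffun (I S : finType) (G : I -> S -> F) :
  \sum_(e : {ffun I -> S}) \prod_i G i (e i) = \prod_i \sum_x G i x.
Proof. by rewrite bigA_distr_bigA. Qed.

(** For fixed horizontal paths, the sum over the vertical spins between two rows factors over the
    columns, so two rows form a single row of stacked vertices. *)
Lemma chain_stack (S1 S2 : finType) n (P : block F S1) (Q : block F S2)
    (t s : 'I_n -> bool) (f g : S1 * S2 -> F) :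
  \sum_(u : {ffun 'I_n -> bool})
    \sum_(e1 : {ffun 'I_n.+1 -> S1}) \sum_(e2 : {ffun 'I_n.+1 -> S2})
      f (e1 ord0, e2 ord0) *
      ((\prod_i P (t i) (u i) (e1 (widen_ord (leqnSn n) i)) (e1 (lift ord0 i))) *
       (\prod_i Q (u i) (s i) (e2 (widen_ord (leqnSn n) i)) (e2 (lift ord0 i)))) *
      g (e1 ord_max, e2 ord_max) =
  chain (fun i => stack P Q (t i) (s i)) f g.
Proof.
rewrite /chain (reindex _ (onW_bij _ (@pair_ffun_bij _ S1 S2))) sum_pair.
rewrite exchange_big; apply: eq_bigr => e1 _.
rewrite exchange_big; apply: eq_bigr => e2 _ /=.
rewrite !ffunE /= -mulr_suml -mulr_sumr; congr (_ * _ * _).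
rewrite /stack -sum_prod_ffun; apply: eq_bigr => u _.
by rewrite -big_split; apply: eq_bigr => i _; rewrite !ffunE.
Qed.

Lemma chain_stack_mul (S1 S2 : finType) n (P : block F S1) (Q : block F S2)
    (t s : 'I_n -> bool) f1 g1 f2 g2 :
  \sum_(u : {ffun 'I_n -> bool})
    chain (fun i => P (t i) (u i)) f1 g1 * chain (fun i => Q (u i) (s i)) f2 g2 =
  chain (fun i => stack P Q (t i) (s i))
    (fun x => f1 x.1 * f2 x.2) (fun x => g1 x.1 * g2 x.2).
Proof.
rewrite -chain_stack; apply: eq_bigr => u _; rewrite mulr_suml.
apply: eq_bigr => e1 _; rewrite mulr_sumr; apply: eq_bigr => e2 _ /=.
ring.
Qed.

(** Vector times matrix. Vectors are finite functions so that pointwise equality is equality and can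
    be rewritten inside a [foldl]. *)
Definition push (T : finType) (b : T -> T -> F) (f : {ffun T -> F}) :
    {ffun T -> F} := [ffun y => \sum_x f x * b x y].

Lemma foldl_map (A I J : Type) (h : I -> J) (op : A -> J -> A) a r :
  foldl op a (map h r) = foldl (fun b i => op b (h i)) a r.
Proof. by elim: r a => //= i r IHr a; rewrite IHr. Qed.

Lemma chain_push (T : finType) n (w : 'I_n -> T -> T -> F) f g :
  chain w f g =
  \sum_y foldl (fun h i => push (w i) h) [ffun x => f x] (enum 'I_n) y * g y.
Proof.
elim: n w f => [|n IHn] w f.
  rewrite chain0 (_ : enum 'I_0 = [::]); last by apply/size0nil; rewrite size_enum_ord.
  by apply: eq_bigr => x _; rewrite ffunE.
rewrite chain_recl IHn enum_ordSl /=; apply: eq_bigr => y _.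
rewrite [in RHS]foldl_map.
set a := [ffun x => _]; set b := push _ _; suff -> : a = b by [].
by apply/ffunP => x; rewrite !ffunE; apply: eq_bigr => v _; rewrite ffunE.
Qed.

Lemma push_comm (T : finType) (b c : T -> T -> F) f :
  (forall x y, \sum_u b x u * c u y = \sum_u c x u * b u y) ->
  push b (push c f) = push c (push b f).
Proof.
move=> bc; apply/ffunP => y; rewrite !ffunE.
under eq_bigr do rewrite ffunE mulr_suml.
under [RHS]eq_bigr do rewrite ffunE mulr_suml.
rewrite exchange_big [RHS]exchange_big /=; apply: eq_bigr => x _.
under eq_bigr do rewrite -mulrA.
under [RHS]eq_bigr do rewrite -mulrA.
by rewrite -!mulr_sumr bc.
Qed.

Lemma foldl_perm (A : Type) (I : eqType) (op : A -> I -> A) (a : A) s1 s2 :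
  (forall h i j, op (op h i) j = op (op h j) i) ->
  perm_eq s1 s2 -> foldl op a s1 = foldl op a s2.
Proof.
(* It is enough to exchange two adjacent blocks of the list. *)
move=> opC; apply: catCA_perm_subst => r1 r2 r3; rewrite !foldl_cat.
congr (foldl _ _ r3).
have opl i r h : foldl op (op h i) r = op (foldl op h r) i.
  by elim: r h => //= j r IHr h; rewrite opC IHr.
by elim: r1 a => //= i r1 IHr1 a; rewrite IHr1 opl.
Qed.

(** By [chain_push] the chain is a fold of operators over [enum 'I_n]; [s] permutes this list, and
    commuting operators may be applied in any order. *)
Lemma chain_perm (T : finType) n (w : 'I_n -> T -> T -> F) f g (s : 'S_n) :
  (forall i j x y, \sum_u w i x u * w j u y = \sum_u w j x u * w i u y) ->
  chain (fun i => w (s i)) f g = chain w f g.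
Proof.
move=> wC; rewrite !chain_push; apply: eq_bigr => y _; congr (_ * _).
congr (fun_of_fin _ y).
rewrite -(foldl_map s (fun h i => push (w i) h)).
apply: foldl_perm => [h i j|]; first by rewrite push_comm.
apply: uniq_perm; rewrite ?(map_inj_uniq perm_inj) ?enum_uniq // => i.
rewrite mem_enum; apply/mapP; exists ((s^-1)%g i); rewrite ?mem_enum //.
by rewrite permKV.
Qed.
End Chain.

(** * Yang-Baxter equations *)

Section YB.
Variables (F : fieldType) (q : F).

(* Crossings of two rows, [u] and [v] being the (upper, lower) spins at their
   right and left ends; D stands for Delta and G for Gamma, upper row first.
   The weights come from [cross_GG], the R-matrix of the stochastic six-vertex
   model: flipping the horizontal spins of a Delta vertex of parameter x gives,
   up to a gauge factor, x' times a Gamma vertex of parameter 1/x'. *)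
Definition cross_GG (x y : F) (u v : bool * bool) : F :=
  match u, v with
  | (true, true), (true, true) | (false, false), (false, false) =>
      1 - (q + 1) * y + q * x * y
  | (true, false), (true, false) => (1 - y) * (1 - q * x)
  | (false, true), (false, true) => (1 - x) * (1 - q * y)
  | (true, false), (false, true) => x - y
  | (false, true), (true, false) => q * (x - y)
  | _, _ => 0
  end.

Definition cross_DD (x y : F) (u v : bool * bool) : F :=
  match u, v with
  | (true, true), (true, true) | (false, false), (false, false) =>
      1 - (q + 1) * x + q * x * y
  | (true, false), (true, false) => (1 - y) * (1 - q * x)
  | (false, true), (false, true) => (1 - x) * (1 - q * y)
  | (true, false), (false, true) => y - x
  | (false, true), (true, false) => q * (y - x)
  | _, _ => 0
  end.

Definition cross_DG (x y : F) (u v : bool * bool) : F :=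
  match u, v with
  | (true, true), (true, true) | (false, false), (false, false) =>
      q * (x + y - (q + 1) * x * y)
  | (true, true), (false, false) => q * (q * x - 1) * (q * y - 1)
  | (false, false), (true, true) => (x - 1) * (y - 1)
  | (true, false), (false, true) =>
      q * ((q + 1) * (x + y) - 1 - (q + 1) ^+ 2 * x * y + q * x * y)
  | (false, true), (true, false) =>
      (q + 1) * (x + y) - 1 - (q + 1) ^+ 2 * x * y + q * x * y
  | _, _ => 0
  end.

Definition cross_GD (x y : F) (u v : bool * bool) : F :=
  match u, v with
  | (true, true), (true, true) | (false, false), (false, false) =>
      q * ((q + 1) * x * y - x - y)
  | (true, true), (false, false) => q * (q * x - 1) * (q * y - 1)
  | (false, false), (true, true) => (x - 1) * (y - 1)
  | (true, false), (false, true) => q * (q * x * y - 1)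
  | (false, true), (true, false) => q * x * y - 1
  | _, _ => 0
  end.

(** Up to a gauge and a scalar, this is [cross_GG] at the parameters [x] and [(zprime q x)^-1] with
    the lower spins flipped at both ends. *)
Definition fish (x : F) (u v : bool * bool) : F :=
  match u, v with
  | (true, true), (true, true) => (q * x - 1) ^+ 2
  | (false, false), (false, false) => (x - 1) ^+ 2
  | (true, false), (true, false) | (false, true), (false, true) =>
      1 - q * x ^+ 2
  | (true, true), (false, false) => q * ((q + 1) * x ^+ 2 - 2 * x)
  | (false, false), (true, true) => (q + 1) * x ^+ 2 - 2 * x
  | _, _ => 0
  end.

Hypothesis q0 : q != 0.

Ltac yang_baxter :=
  move=> [] [] [[] []] [[] []];
  rewrite !big_bool_pair /stack /row_block /= !big_bool /=
    ?(mul0r, mulr0, addr0, add0r) //.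

(** Each of these relations is verified on all 64 boundary values. Delta vertices divide by [q] and
    by their parameter, hence the nonvanishing assumed for Delta parameters in the next ones. *)
Lemma yang_baxter_GG (x y : F) :
  intertwines (cross_GG x y)
    (stack (row_block (gamma_weight q x)) (row_block (gamma_weight q y)))
    (stack (row_block (gamma_weight q y)) (row_block (gamma_weight q x))).
Proof. yang_baxter; ring. Qed.

Lemma yang_baxter_DD (x y : F) : x != 0 -> y != 0 ->
  intertwines (cross_DD x y)
    (stack (row_block (delta_weight q x)) (row_block (delta_weight q y)))
    (stack (row_block (delta_weight q y)) (row_block (delta_weight q x))).
Proof.
move=> x0 y0; rewrite /delta_weight /zprime;
yang_baxter; field; rewrite ?q0 ?x0 ?y0 //.
Qed.

Lemma yang_baxter_DG (x y : F) : x != 0 ->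
  intertwines (cross_DG x y)
    (stack (row_block (delta_weight q x)) (row_block (gamma_weight q y)))
    (stack (row_block (gamma_weight q y)) (row_block (delta_weight q x))).
Proof.
move=> x0; rewrite /delta_weight /zprime;
yang_baxter; field; rewrite ?q0 ?x0 //.
Qed.

Lemma yang_baxter_GD (x y : F) : y != 0 ->
  intertwines (cross_GD x y)
    (stack (row_block (gamma_weight q x)) (row_block (delta_weight q y)))
    (stack (row_block (delta_weight q y)) (row_block (gamma_weight q x))).
Proof.
move=> x0; rewrite /delta_weight /zprime;
yang_baxter; field; rewrite ?q0 ?x0 //.
Qed.

Definition scale_block (S : Type) (c : F) (P : block F S) : block F S :=
  fun t s x y => c * P t s x y.

Lemma mul_zprime (x : F) : x != 0 -> x * zprime q x = (q + 1) * x - 1.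
Proof. by move=> x0; rewrite /zprime; field. Qed.

Lemma zprimeV (x : F) : x != 0 -> (zprime q x)^-1 = x / ((q + 1) * x - 1).
Proof. by move=> x0; rewrite -mul_zprime // invfM mulVKf. Qed.

(** The scalar is [x * zprime q x]: one factor [zprime q x] from reading the Delta vertex as a
    flipped Gamma vertex, one factor [x] from the reverse change in the other row. Over [L] columns
    it accounts for the powers [z ^+ L] of the normalization. *)
Lemma yang_baxter_fish (x : F) (x' := (zprime q x)^-1) :
  x != 0 -> zprime q x != 0 ->
  intertwines (fish x)
    (stack (row_block (gamma_weight q x)) (row_block (delta_weight q x)))
    (scale_block (x / x')
      (stack (row_block (gamma_weight q x')) (row_block (delta_weight q x')))).
Proof.
move=> x0 h; have h1 : (q + 1) * x - 1 != 0.
  by rewrite -mul_zprime // mulf_neq0.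
rewrite /x' zprimeV // /scale_block /delta_weight /zprime.
yang_baxter; field; rewrite ?q0 ?x0 ?h1 //.
Qed.
End YB.

(** * Crossings absorbed by the caps *)

Section Pull.
Variable F : fieldType.

Definition pull (S : finType) (X : S -> S -> F) (f : S -> F) : S -> F :=
  fun y => \sum_x f x * X x y.

(** This and the next two lemmas collapse the strands on which the crossing is the identity, leaving
    a sum over the crossing rows only. *)
Lemma pull_down (S1 S2 : finType) (X : S1 -> S1 -> F)
    (f : S1 * S2 -> F) (y1 : S1) (y2 : S2) :
  pull (extend_down X) f (y1, y2) = \sum_x f (x, y2) * X x y1 :> F.
Proof.
rewrite /pull sum_pair; apply: eq_bigr => x _; rewrite /extend_down /=.
under eq_bigr do rewrite mulrA.
exact: (sum_eqr (fun v => f (x, v) * X x y1)).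
Qed.

Lemma pull_up (S1 S2 : finType) (X : S2 -> S2 -> F)
    (f : S1 * S2 -> F) (y1 : S1) (y2 : S2) :
  pull (extend_up X) f (y1, y2) = \sum_x f (y1, x) * X x y2 :> F.
Proof.
rewrite /pull sum_pair exchange_big; apply: eq_bigr => x _.
rewrite /extend_up /=; under eq_bigr do rewrite mulrCA mulrC.
exact: (sum_eqr (fun v => f (v, x) * X x y2)).
Qed.

Lemma pull_mid (A B D : finType) (X : B * B -> B * B -> F)
    (f : (A * B) * (B * D) -> F)
    (a : A) (b c : B) (d : D) :
  pull (extend_mid X) f ((a, b), (c, d)) =
  \sum_p f ((a, p.1), (p.2, d)) * X p (b, c) :> F.
Proof.
transitivity (pull (extend_up (extend_down X)) (f \o @ungroup A B B D)
                (a, (b, c, d))).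
  rewrite /pull (reindex _ (onW_bij _ (@ungroup_bij A B B D))) /=.
  by apply: eq_bigr => u _; rewrite /extend_mid ungroupK.
rewrite pull_up.
exact: (pull_down X (fun x => f (ungroup (a, x)))).
Qed.
End Pull.

Section Chain.
Variable F : fieldType.

(** With left boundary [v] the crossing is frozen: only [u] can precede it, with weight [c]. Moving
    it to the right end trades this scalar for its action on [f]. *)
Lemma chain_delta (S : finType) n (w w' : 'I_n -> S -> S -> F) X f c u v :
  (forall i x y, \sum_u w i x u * X u y = \sum_u X x u * w' i u y) ->
  (forall x, X x v = c * (x == u)%:R) ->
  c * chain w f (fun x => (x == u)%:R) =
  chain w' (pull X f) (fun x => (x == v)%:R).
Proof.
move=> wX Xv; rewrite -(chain_intertwine _ _ wX) -chain_mulr.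
by apply: eq_chain => // x; rewrite -Xv -(sum_eqr (X x)).
Qed.
End Chain.

Section Caduceus.
Variables (F : fieldType) (q z w : F).

(** Read from the inside out. From top to bottom the rows pass from GDGD ([z], [z], [w], [w]) to
    GGDD by the middle crossing, then the two G rows and the two D rows are exchanged, and a last
    middle crossing gives GDGD ([w], [w], [z], [z]). *)
Definition caduceus (f : (bool * bool) * (bool * bool) -> F) :=
  pull (extend_mid (cross_GD q z w)) (pull (extend_up (cross_DD q z w))
    (pull (extend_down (cross_GG q z w)) (pull (extend_mid (cross_DG q z w)) f))).

Definition caduceus_coef : F :=
  q * ((q + 1) * (z + w) - 1 - (q + 1) ^+ 2 * z * w + q * z * w) *
  (1 - (q + 1) * w + q * z * w) * (1 - (q + 1) * z + q * z * w) *
  (q * z * w - 1).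

Lemma caduceus_coef_neq0 :
  q != 0 ->
  (q + 1) * (z + w) - 1 - (q + 1) ^+ 2 * z * w + q * z * w != 0 ->
  1 - (q + 1) * w + q * z * w != 0 -> 1 - (q + 1) * z + q * z * w != 0 ->
  q * z * w - 1 != 0 -> caduceus_coef != 0.
Proof. by move=> *; rewrite !mulf_neq0. Qed.
End Caduceus.

(** * Row pairs: interchange and commutation *)

Section DoubleRow.
Variables (F : fieldType) (q : F) (L : nat) (cap : bool -> bool -> F).

Definition double_block (z : F) : block F (bool * bool) :=
  stack (row_block (gamma_weight q z)) (row_block (delta_weight q z)).

Definition double_row (z : F) (b t : {ffun 'I_L -> bool}) : F :=
  chain (fun j => double_block z (t j) (b j))
        (fun x => cap x.1 x.2) (fun x => (x == (Minus, Plus))%:R).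

Hypothesis q0 : q != 0.

(** [1 - q * z ^+ 2] is the only nonzero weight of the fish with left spins [(Minus, Plus)], and [c]
    is its eigenvalue on the cap vector. *)
Lemma double_row_interchange c (z : F) (z' := (zprime q z)^-1) b t :
  z != 0 -> zprime q z != 0 ->
  (forall y, \sum_x cap x.1 x.2 * fish q z x y = c * cap y.1 y.2) ->
  (1 - q * z ^+ 2) * double_row z b t =
  c * ((z / z') ^+ L * double_row z' b t).
Proof.
move=> z0 zp0 capc.
rewrite [LHS](chain_delta _ (X := fish q z) (v := (Minus, Plus))
  (w' := fun j => scale_block (z / z') (double_block z') (t j) (b j))).
- rewrite chain_mulw prodr_const card_ord mulrCA; congr (_ * _).
  by rewrite -chain_mull; apply: eq_chain.
- by move=> j x y; apply: yang_baxter_fish.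
- by case=> [[] []] /=; rewrite ?mulr1 ?mulr0.
Qed.

(* With all left spins fixed the four crossings contribute only
   [caduceus_coef], so commutation reduces to the caps being an eigenvector for
   that eigenvalue. *)
Lemma double_row_comm (z w : F) b t :
  z != 0 -> w != 0 -> caduceus_coef q z w != 0 ->
  (forall y, caduceus q z w (fun x => cap x.1.1 x.1.2 * cap x.2.1 x.2.2) y =
             caduceus_coef q z w * (cap y.1.1 y.1.2 * cap y.2.1 y.2.2)) ->
  \sum_u double_row z u t * double_row w b u =
  \sum_u double_row w u t * double_row z b u.
Proof.
move=> z0 w0 d0 capE.
have delta2 (x : (bool * bool) * (bool * bool)) :
    (x.1 == (false, true))%:R * (x.2 == (false, true))%:R =
    (x == ((false, true), (false, true)))%:R :> F.
  by case: x => x1 x2; rewrite xpair_eqE; do 2!case: eqP => _; rewrite ?mulr1 ?mulr0.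
(* Both sides become chains of four rows; on the right the coefficient is absorbed by [capE], which
   replaces the caps by their image under the braid. *)
rewrite !chain_stack_mul; apply: (mulfI d0); rewrite -[RHS]chain_mull.
rewrite (eq_chain (fun _ _ _ => erefl) (frefl _) delta2).
rewrite [RHS](eq_chain (fun _ _ _ => erefl) (fun y => esym (capE y)) delta2).
set f := fun x => cap _ _ * _.
pose G x := row_block (gamma_weight q x); pose D x := row_block (delta_weight q x).
pose chain4 (P Q R T : block F bool) :=
  chain (fun i => stack (stack P Q) (stack R T) (t i) (b i)).
pose delta u (x : (bool * bool) * (bool * bool)) : F := (x == u)%:R.
(* The left spins, from top to bottom, go from -+-+ to --++ here, stay so for the GG and DD
   crossings, and return to -+-+ with the last crossing. *)
have swap2 h :
    q * ((q + 1) * (z + w) - 1 - (q + 1) ^+ 2 * z * w + q * z * w) *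
    chain4 (G z) (D z) (G w) (D w) h
      (delta ((false, true), (false, true))) =
    chain4 (G z) (G w) (D z) (D w) (pull (extend_mid (cross_DG q z w)) h)
      (delta ((false, false), (true, true))).
  apply: chain_delta => [i x y|].
    by apply: intertwines_mid; apply: yang_baxter_DG.
  case=> [[[] []] [[] []]]; rewrite /extend_mid /extend_up /extend_down /=; ring.
have swap1 h : (1 - (q + 1) * w + q * z * w) * chain4 (G z) (G w) (D z) (D w) h
      (delta ((false, false), (true, true))) =
    chain4 (G w) (G z) (D z) (D w) (pull (extend_down (cross_GG q z w)) h)
      (delta ((false, false), (true, true))).
  apply: chain_delta => [i x y|].
    by apply: intertwines_stackl; apply: yang_baxter_GG.
  case=> [[[] []] [[] []]]; rewrite /extend_mid /extend_up /extend_down /=; ring.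
have swap3 h : (1 - (q + 1) * z + q * z * w) * chain4 (G w) (G z) (D z) (D w) h
      (delta ((false, false), (true, true))) =
    chain4 (G w) (G z) (D w) (D z) (pull (extend_up (cross_DD q z w)) h)
      (delta ((false, false), (true, true))).
  apply: chain_delta => [i x y|].
    by apply: intertwines_stackr; apply: yang_baxter_DD.
  case=> [[[] []] [[] []]]; rewrite /extend_mid /extend_up /extend_down /=; ring.
have swap2' h : (q * z * w - 1) * chain4 (G w) (G z) (D w) (D z) h
      (delta ((false, false), (true, true))) =
    chain4 (G w) (D w) (G z) (D z) (pull (extend_mid (cross_GD q z w)) h)
      (delta ((false, true), (false, true))).
  apply: chain_delta => [i x y|].
    by apply: intertwines_mid; apply: yang_baxter_GD.
  case=> [[[] []] [[] []]]; rewrite /extend_mid /extend_up /extend_down /=; ring.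
rewrite -[RHS]/(chain4 (G w) (D w) (G z) (D z) _ _) /caduceus.
rewrite -swap2' -swap3 -swap1 -swap2.
by rewrite /caduceus_coef /chain4 /double_block; ring.
Qed.
End DoubleRow.

(** * Caps as eigenvectors of the braids *)

Section Caps.
Variables (F : fieldType) (q : F).

(** The eigenvalue is [((q + 1) * z - 1) ^+ 2 - q * z ^+ 2]. It differs from the left weight
    [1 - q * z ^+ 2], and the extra factor of [D1] compensates for the quotient of the two. *)
Lemma fish_reflecting (z : F) y :
  \sum_x reflecting_cap F x.1 x.2 * fish q z x y =
  ((q ^+ 2 + q + 1) * z ^+ 2 - 2 * (q + 1) * z + 1) * reflecting_cap F y.1 y.2.
Proof.
by case: y => [[] []]; rewrite big_bool_pair /reflecting_cap /=; ring.
Qed.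

(** Here the eigenvalue equals the left weight, so [D2] consists of powers of the parameters
    alone. *)
Lemma fish_absorbing_emitting (z : F) y :
  \sum_x absorbing_emitting_cap F x.1 x.2 * fish q z x y =
  (1 - q * z ^+ 2) * absorbing_emitting_cap F y.1 y.2.
Proof.
by case: y => [[] []]; rewrite big_bool_pair /absorbing_emitting_cap /=; ring.
Qed.

Ltac caduceus_tac :=
  case=> [[[] []] [[] []]]; rewrite /caduceus /caduceus_coef pull_mid big_bool_pair /=
    ?(mulr0, addr0, add0r) !pull_up !big_bool_pair /= ?(mulr0, addr0, add0r)
    !pull_down !big_bool_pair /= ?(mulr0, addr0, add0r)
    !pull_mid !big_bool_pair /= ?(mulr0, mul0r, mul1r, addr0, add0r).

Lemma caduceus_reflecting (z w : F) : forall y,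
  caduceus q z w
    (fun x => reflecting_cap F x.1.1 x.1.2 * reflecting_cap F x.2.1 x.2.2) y =
    caduceus_coef q z w * (reflecting_cap F y.1.1 y.1.2 * reflecting_cap F y.2.1 y.2.2).
Proof. by rewrite /reflecting_cap; caduceus_tac; ring. Qed.

Lemma caduceus_absorbing_emitting (z w : F) : forall y,
  caduceus q z w
    (fun x => absorbing_emitting_cap F x.1.1 x.1.2 *
              absorbing_emitting_cap F x.2.1 x.2.2) y =
    caduceus_coef q z w *
    (absorbing_emitting_cap F y.1.1 y.1.2 *
     absorbing_emitting_cap F y.2.1 y.2.2).
Proof. by rewrite /absorbing_emitting_cap; caduceus_tac; ring. Qed.
End Caps.

(** * The partition function as a product of transfer operators *)

Section Levels.
Variables (n L : nat).

Lemma even_level_subproof (k : 'I_n.+1) : (k.*2 < (n.*2).+1)%N.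
Proof. by rewrite ltnS leq_double -ltnS. Qed.

Definition even_level (k : 'I_n.+1) : 'I_(n.*2).+1 :=
  Ordinal (even_level_subproof k).

Definition odd_level (i : 'I_n) : 'I_(n.*2).+1 := above (delta_row i).

(** Even levels separate row pairs and are the states of the transfer operators; odd levels lie
    inside a pair and are summed within [double_row]. *)
Definition split_vspins (v : vspins n L) :
    {ffun 'I_n.+1 -> {ffun 'I_L -> bool}} * {ffun 'I_n -> {ffun 'I_L -> bool}} :=
  ([ffun k => [ffun j => v (even_level k, j)]],
   [ffun i => [ffun j => v (odd_level i, j)]]).

Definition split_hspins (h : hspins n L) :
    {ffun 'I_n -> {ffun 'I_L.+1 -> bool}} * {ffun 'I_n -> {ffun 'I_L.+1 -> bool}} :=
  ([ffun i => [ffun k => h (gamma_row i, k)]],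
   [ffun i => [ffun k => h (delta_row i, k)]]).

Lemma split_vspins_bij : bijective split_vspins.
Proof.
(* Injectivity suffices, since the level counts agree: 2n+1 = (n+1) + n. *)
apply: inj_card_bij; last first.
  rewrite card_prod !card_ffun !card_prod !card_ord card_bool -!expnM -expnD.
  by rewrite -mulnDr addSn addnn mulnC.
move=> v v' [/ffunP ee /ffunP eo]; apply/ffunP => -[k j].
have kE := odd_double_half k; case: (odd k) kE => [] kE.
  have lt_k : (k./2 < n)%N by have := ltn_ord k; rewrite -{1}kE add1n ltnS ltn_double.
  rewrite (_ : k = odd_level (Ordinal lt_k)); last exact/val_inj/esym.
  by have /ffunP/(_ j) := eo (Ordinal lt_k); rewrite !ffunE.
have lt_k : (k./2 < n.+1)%N by have := ltn_ord k; rewrite -{1}kE add0n !ltnS leq_double.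
rewrite (_ : k = even_level (Ordinal lt_k)); last exact/val_inj/esym.
by have /ffunP/(_ j) := ee (Ordinal lt_k); rewrite !ffunE.
Qed.

Lemma split_hspins_bij : bijective split_hspins.
Proof.
apply: inj_card_bij; last first.
  rewrite card_prod !card_ffun !card_prod !card_ord card_bool -!expnM -expnD.
  by rewrite -mulnDr addnn mulnC.
move=> h h' [/ffunP eg /ffunP ed]; apply/ffunP => -[r j].
have rE := odd_double_half r; have lt_r : (r./2 < n)%N.
  by rewrite -ltn_double (leq_ltn_trans _ (ltn_ord r)) // -{2}rE leq_addl.
case: (odd r) rE => [] rE.
  rewrite (_ : r = gamma_row (Ordinal lt_r)); last exact/val_inj/esym.
  by have /ffunP/(_ j) := eg (Ordinal lt_r); rewrite !ffunE.
rewrite (_ : r = delta_row (Ordinal lt_r)); last exact/val_inj/esym.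
by have /ffunP/(_ j) := ed (Ordinal lt_r); rewrite !ffunE.
Qed.
End Levels.

Section PartitionFunction.
Variables (F : fieldType) (n m L : nat) (lam : m.-tuple nat).
Variables (cap : bool -> bool -> F) (q : F) (z : 'I_n -> F).

Lemma partition_function_chain :
  partition_function L lam cap q z =
  chain (fun i : 'I_n => double_row q cap (z i))
    (fun b : {ffun 'I_L -> bool} => (b == [ffun j => bottom_spin lam j])%:R)
    (fun t => (t == [ffun => Plus])%:R).
Proof.
(* The weight of a row pair with all its spins fixed, its left boundary condition being an indicator
   factor. *)
pose rw z (b t u : {ffun 'I_L -> bool}) (a c : {ffun 'I_L.+1 -> bool}) :=
  cap (a ord0) (c ord0) *
  ((\prod_j row_block (gamma_weight q z) (t j) (u j)
       (a (widen_ord (leqnSn L) j)) (a (lift ord0 j))) *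
   (\prod_j row_block (delta_weight q z) (u j) (b j)
       (c (widen_ord (leqnSn L) j)) (c (lift ord0 j)))) *
  ((a ord_max, c ord_max) == (Minus, Plus))%:R.
pose f (b : {ffun 'I_L -> bool}) : F := (b == [ffun j => bottom_spin lam j])%:R.
pose g t : F := (t == [ffun => Plus] :> {ffun 'I_L -> bool})%:R.
(* The chain is expanded into a sum over all spins with indicators for the boundary conditions;
   splitting spins by levels and rows then matches it with the states term by term. *)
transitivity (\sum_(e : {ffun 'I_n.+1 -> {ffun 'I_L -> bool}})
  \sum_(u : {ffun 'I_n -> {ffun 'I_L -> bool}})
  \sum_(p : {ffun 'I_n -> {ffun 'I_L.+1 -> bool}} *
            {ffun 'I_n -> {ffun 'I_L.+1 -> bool}})
    f (e ord0) *
    (\prod_i rw (z i) (e (widen_ord (leqnSn n) i)) (e (lift ord0 i))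
                (u i) (p.1 i) (p.2 i)) * g (e ord_max)); last first.
  apply: eq_bigr => e _.
  under [in RHS]eq_bigr => i _ do rewrite /double_row -chain_stack.
  rewrite -sum_prod_ffun mulr_sumr mulr_suml; apply: eq_bigr => u _.
  rewrite -sum_prod_ffun mulr_sumr mulr_suml sum_pair; apply: eq_bigr => a _.
  by rewrite -sum_prod_ffun mulr_sumr mulr_suml.
rewrite pair_bigA (reindex _ (onW_bij _ (@split_vspins_bij n L))) /=.
apply: eq_bigr => v _; rewrite big_mkcond.
rewrite [RHS](reindex _ (onW_bij _ (@split_hspins_bij n L))) /=.
apply: eq_bigr => h _.
rewrite (_ : \prod_i _ =
  (\prod_i ((h (gamma_row i, ord_max), h (delta_row i, ord_max)) ==
            (Minus, Plus))%:R) * state_weight cap q z v h); last first.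
  rewrite /state_weight -big_split; apply: eq_bigr => i _; rewrite /rw /= !ffunE.
  rewrite mulrC; congr (_ * _); rewrite [RHS]mulrC; congr (_ * _).
  rewrite [RHS]mulrC; congr (_ * _).
  apply: eq_bigr => j _.
    rewrite !ffunE /vertex /row_block /left_of /right_of.
    rewrite (_ : even_level _ = above (gamma_row i)); last exact/val_inj.
    by rewrite (_ : odd_level _ = below (gamma_row i)) //; apply/val_inj.
  apply: eq_bigr => j _; rewrite !ffunE /vertex /row_block /left_of /right_of.
  by rewrite (_ : even_level _ = below (delta_row i)) //; apply/val_inj.
rewrite !ffunE /f /g.
have -> : ([ffun j => v (even_level ord0, j)] == [ffun j => bottom_spin lam j]) =
    [forall j, v (ord0, j) == bottom_spin lam j].
  rewrite (_ : even_level ord0 = ord0); last exact/val_inj.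
  apply/eqP/forallP => [/ffunP e j|e]; first by have := e j; rewrite !ffunE => ->.
  by apply/ffunP => j; rewrite !ffunE (eqP (e j)).
have -> : ([ffun j => v (even_level ord_max, j)] == [ffun => Plus]) =
    [forall j, v (ord_max, j) == Plus].
  rewrite (_ : even_level ord_max = ord_max); last exact/val_inj.
  apply/eqP/forallP => [/ffunP e j|e]; first by have := e j; rewrite !ffunE => ->.
  by apply/ffunP => j; rewrite !ffunE (eqP (e j)).
rewrite /admissible.
(* A violated left condition kills one indicator in the product, just as [admissible] discards the
   state. *)
case: (boolP [forall i, h (gamma_row i, ord_max) == Minus]) =>
    [/forallP hG | /forallPn[i hi]]; last first.
  rewrite (_ : \prod_i _ = 0) ?mul0r ?mulr0 ?mul0r //.
  by apply/eqP/prodf_eq0; exists i => //; rewrite xpair_eqE (negPf hi).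
case: (boolP [forall i, h (delta_row i, ord_max) == Plus]) =>
    [/forallP hD | /forallPn[i hi]]; last first.
  rewrite (_ : \prod_i _ = 0) ?mul0r ?mulr0 ?mul0r //.
  by apply/eqP/prodf_eq0; exists i => //; rewrite xpair_eqE (negPf hi) andbF.
rewrite big1 ?mul1r; last by move=> i _; rewrite xpair_eqE hG hD.
by do 2!case: [forall j, _]; rewrite /= ?(mul1r, mulr1, mul0r, mulr0).
Qed.
End PartitionFunction.

(** * Normalized partition functions *)

Section Normalized.
Variables (F : fieldType) (n m L : nat) (lam : m.-tuple nat).
Variables (cap : bool -> bool -> F) (q : F).

(** A normalization that is a product over the parameters can be distributed over the transfer
    operators, which reduces both symmetries to statements about these operators. *)
Lemma partition_function_div (z : 'I_n -> F) (d : F -> F) :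
  partition_function L lam cap q z / \prod_i d (z i) =
  chain (fun i b t => (d (z i))^-1 * double_row q cap (z i) b t)
    (fun b : {ffun 'I_L -> bool} => (b == [ffun j => bottom_spin lam j])%:R)
    (fun t => (t == [ffun => Plus])%:R).
Proof. by rewrite partition_function_chain chain_mulw prodfV mulrC. Qed.

Lemma partition_function_perm (z : 'I_n -> F) (d : F -> F) (s : 'S_n) :
  (forall i j (b t : {ffun 'I_L -> bool}),
     \sum_u double_row q cap (z i) u t * double_row q cap (z j) b u =
     \sum_u double_row q cap (z j) u t * double_row q cap (z i) b u) ->
  partition_function L lam cap q (fun i => z (s i)) / \prod_i d (z (s i)) =
  partition_function L lam cap q z / \prod_i d (z i).
Proof.
move=> comm; rewrite [LHS](partition_function_div (fun i => z (s i))).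
rewrite partition_function_div.
apply: (chain_perm (w := fun i b t => (d (z i))^-1 * double_row q cap (z i) b t) _ _ s).
move=> i j b t; under eq_bigr do rewrite mulrACA.
under [RHS]eq_bigr do rewrite mulrACA.
rewrite -!mulr_sumr [in RHS](mulrC (d (z j))^-1); congr (_ * _).
under eq_bigr do rewrite mulrC.
under [RHS]eq_bigr do rewrite mulrC.
by rewrite comm.
Qed.

Lemma partition_function_interchange (z : 'I_n -> F) (d : F -> F) (i : 'I_n) :
  (forall b t : {ffun 'I_L -> bool},
     (d (z i))^-1 * double_row q cap (z i) b t =
     (d (zprime q (z i))^-1)^-1 * double_row q cap (zprime q (z i))^-1 b t) ->
  partition_function L lam cap q (interchange_z q i z) /
    \prod_k d (interchange_z q i z k) =
  partition_function L lam cap q z / \prod_k d (z k).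
Proof.
move=> inv; rewrite !partition_function_div; apply: eq_chain => // k b t.
by rewrite /interchange_z; case: eqP => // ->; rewrite inv.
Qed.

(** The condition on [e] makes [e z / e z'] equal to [c / (1 - q * z ^+ 2)], the scalar left over by
    the fish once the powers of [z] and [z'] are accounted for. *)
Lemma double_row_div_interchange (z c : F) (e : F -> F) (z' := (zprime q z)^-1)
    (b t : {ffun 'I_L -> bool}) :
  q != 0 -> z != 0 -> zprime q z != 0 -> 1 - q * z ^+ 2 != 0 ->
  e z != 0 -> e z' != 0 -> c * e z' = (1 - q * z ^+ 2) * e z ->
  (forall y, \sum_x cap x.1 x.2 * fish q z x y = c * cap y.1 y.2) ->
  (z ^+ L * e z)^-1 * double_row q cap z b t =
  (z' ^+ L * e z')^-1 * double_row q cap z' b t.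
Proof.
move=> q0 z0 zp0 qz0 ez0 ez'0 ce capE.
have z'0 : z' != 0 by rewrite invr_eq0.
have := double_row_interchange q0 b t z0 zp0 capE; rewrite -/z' => DR.
apply: (mulfI qz0); rewrite mulrCA DR expr_div_n.
apply: (mulfI ez'0).
transitivity (c * e z' * (z' ^+ L)^-1 * (e z)^-1 * double_row q cap z' b t).
  by field; rewrite ez0 !expf_neq0.
by rewrite ce; field; rewrite ez0 ez'0 expf_neq0.
Qed.
End Normalized.

Section Reflecting.
Variables (F : fieldType) (q z : F).
Let z' := (zprime q z)^-1.
Local Notation a := ((q + 1) * z - 1).
Let e (x : F) := 1 - (q + 1) * x + q * x * (zprime q x)^-1.
Hypotheses (z0 : z != 0) (a0 : a != 0).

Lemma zprime_neq0 : zprime q z != 0.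
Proof. by move: a0; rewrite -mul_zprime // mulf_eq0 negb_or => /andP[]. Qed.

Lemma reflecting_factor : e z = (q * z ^+ 2 - a ^+ 2) / a.
Proof. by rewrite /e zprimeV //; field. Qed.

Lemma reflecting_factor_interchange : e z' = (q * z ^+ 2 - 1) / a.
Proof.
have z'E : z' = z / a by rewrite /z' zprimeV.
(* The interchange is an involution. *)
rewrite /e (_ : zprime q z' = z^-1) ?invrK.
  by rewrite z'E; field.
by rewrite /zprime z'E; field; rewrite z0.
Qed.
End Reflecting.

(** * Invariance *)

Section Invariance.
Variables (F : fieldType) (n L : nat) (q : F) (z : 'I_n -> F).
Hypothesis q0 : q != 0.
Hypothesis z0 : forall i, z i != 0.
Hypothesis a0 : forall i, (q + 1) * z i - 1 != 0.
Hypothesis fish0 : forall i, 1 - q * z i ^+ 2 != 0.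
Hypothesis caduceus0 : forall i j, caduceus_coef q (z i) (z j) != 0.
Hypothesis D1_neq0 : forall i, q * z i ^+ 2 - ((q + 1) * z i - 1) ^+ 2 != 0.

Let e (x : F) := 1 - (q + 1) * x + q * x * (zprime q x)^-1.

Let D1E y : D1 L q y = \prod_(i < n) (y i ^+ L * e (y i)).
Proof. by rewrite big_split. Qed.

Let D2E y : D2 L y = \prod_(i < n) (y i ^+ L * 1) :> F.
Proof. by apply: eq_bigr => i _; rewrite mulr1. Qed.

Lemma reflecting_perm (lam : n.-tuple nat) (s : 'S_n) :
  Z_reflecting L lam q (fun i => z (s i)) / D1 L q (fun i => z (s i)) =
  Z_reflecting L lam q z / D1 L q z.
Proof.
rewrite !D1E; apply: (partition_function_perm lam (fun x => x ^+ L * e x)).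
move=> i j b t; apply: double_row_comm => // y.
exact: caduceus_reflecting.
Qed.

Lemma absorbing_emitting_perm m (lam : m.-tuple nat) (s : 'S_n) :
  Z_absorbing_emitting L lam q (fun i => z (s i)) / D2 L (fun i => z (s i)) =
  Z_absorbing_emitting L lam q z / D2 L z.
Proof.
rewrite !D2E; apply: (partition_function_perm lam (fun x => x ^+ L * 1)).
move=> i j b t; apply: double_row_comm => // y.
exact: caduceus_absorbing_emitting.
Qed.

Lemma reflecting_interchange (lam : n.-tuple nat) i :
  Z_reflecting L lam q (interchange_z q i z) / D1 L q (interchange_z q i z) =
  Z_reflecting L lam q z / D1 L q z.
Proof.
rewrite !D1E /Z_reflecting.
apply: (@partition_function_interchange F n n L lam _ q z
          (fun x => x ^+ L * e x) i).
have ai0 := a0 i; have e1 := reflecting_factor (z0 i) ai0.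
have e2 := reflecting_factor_interchange (z0 i) ai0.
move=> b t; apply: (double_row_div_interchange (e := e) _ _ q0 _ _ _ _ _ _
                      (fish_reflecting q (z i))) => //.
- exact: zprime_neq0.
- by rewrite /e e1 mulf_neq0 ?invr_eq0.
- by rewrite /e e2 mulf_neq0 ?invr_eq0 // -oppr_eq0 opprB.
- by rewrite /e e1 e2; field.
Qed.

Lemma absorbing_emitting_interchange m (lam : m.-tuple nat) i :
  Z_absorbing_emitting L lam q (interchange_z q i z) / D2 L (interchange_z q i z) =
  Z_absorbing_emitting L lam q z / D2 L z.
Proof.
rewrite !D2E.
apply: (@partition_function_interchange F n m L lam _ q z
          (fun x => x ^+ L * 1) i).
move=> b t; apply: (double_row_div_interchange (e := fun=> 1) _ _ q0 _ _ _ _ _ _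
                      (fish_absorbing_emitting q (z i))) => //.
- exact: zprime_neq0.
- exact: oner_neq0.
- exact: oner_neq0.
Qed.
End Invariance.

(* The origin is a usable test point over every field K, however small. *)
Lemma fraction_neq0 (K : fieldType) k (p : {mpoly K[k]}) (x : {fraction {mpoly K[k]}}) :
  x = tofrac p -> p.@[fun=> 0] != 0 -> x != 0.
Proof.
move=> ->; apply: contraNneq => /eqP; rewrite tofrac_eq0 => /eqP->.
by rewrite meval0.
Qed.

(** * Nonvanishing at the generic point *)

Section Generic.
Variables (K : fieldType) (n : nat).
Let q := q_var K n.
Let z := @z_var K n.
Let X i : {mpoly K[n.+1]} := 'X_(lift ord0 i).
Let Q : {mpoly K[n.+1]} := 'X_ord0.

Ltac generic p :=
  apply: (@fraction_neq0 K n.+1 p);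
  [ by rewrite ?(rmorphB, rmorphD, rmorphM, rmorphXn, rmorph1)
  | by rewrite ?(mevalB, mevalD, mevalM, mevalXU, meval1, rmorphXn) /=
       ?(mulr0, mul0r, addr0, add0r, subr0, sub0r, oppr_eq0, oner_eq0,
         mulrNN, mulr1) ].

(** Variables vanish at the origin, so evaluation there says nothing; a monomial is nonzero because
    its support is nonempty. *)
Lemma q_var_neq0 : q != 0.
Proof. by rewrite tofrac_eq0 -msupp_eq0 msuppX. Qed.

Lemma z_var_neq0 i : z i != 0.
Proof. by rewrite tofrac_eq0 -msupp_eq0 msuppX. Qed.

Lemma generic_a i : (q + 1) * z i - 1 != 0.
Proof. generic ((Q + 1) * X i - 1). Qed.

Lemma generic_fish i : 1 - q * z i ^+ 2 != 0.
Proof. generic (1 - Q * X i ^+ 2). Qed.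

Lemma generic_D1 i : q * z i ^+ 2 - ((q + 1) * z i - 1) ^+ 2 != 0.
Proof. generic (Q * X i ^+ 2 - ((Q + 1) * X i - 1) ^+ 2). Qed.

(** Apart from [q], every factor has constant term 1 or -1, also when [i = j]. *)
Lemma generic_caduceus i j : caduceus_coef q (z i) (z j) != 0.
Proof.
apply: caduceus_coef_neq0.
- exact: q_var_neq0.
- generic ((Q + 1) * (X i + X j) - 1 - (Q + 1) ^+ 2 * X i * X j + Q * X i * X j).
- generic (1 - (Q + 1) * X j + Q * X i * X j).
- generic (1 - (Q + 1) * X i + Q * X i * X j).
- generic (Q * X i * X j - 1).
Qed.
End Generic.

Unset Implicit Arguments.

Theorem theorem2p3 (K : fieldType) (n L : nat) (hn : (1 <= n)%N) (hL : (1 <= L)%N) :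
  (forall lam : n.-tuple nat,
     is_partition lam -> (head 0 lam + n <= L)%N ->
     invariant_ratfun (fun (q : ratfun K n) (z : 'I_n -> ratfun K n) =>
                  Z_reflecting L lam q z / D1 L q z)) /\
  (forall (m : nat) (lam : m.-tuple nat),
     (1 <= m)%N -> is_partition lam -> (head 0 lam + m <= L)%N ->
     invariant_ratfun (fun (q : ratfun K n) (z : 'I_n -> ratfun K n) =>
                  Z_absorbing_emitting L lam q z / D2 L z)).
Proof.
have q0 := q_var_neq0 K n; have z0 := @z_var_neq0 K n.
have a0 := @generic_a K n; have f0 := @generic_fish K n.
have c0 := @generic_caduceus K n; have d0 := @generic_D1 K n.
split=> [lam _ _|m lam _ _ _]; split=> [s|i].
- exact: reflecting_perm.
- exact: reflecting_interchange.
- exact: absorbing_emitting_perm.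
- exact: absorbing_emitting_interchange.
Qed.
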